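(* There exists an absolute constant $C$ such that, for $\delta>0$, any analytic set $A\subset\mathbb{R}^n$ with $\dim(A)>\frac{C}{\delta}\log\left(\frac1\delta\right)$ contains an angle from the $\delta$-neighborhood of $120^\circ$. Therefore $\widetilde{C}(120^\circ,\delta)\le\frac{C}{\delta}\log\left(\frac1\delta\right)$.
   Context: A set $A\subset\mathbb{R}^n$ contains the angle $\alpha\in[0,180^\circ]$ if there exist distinct points $x,y,z\in A$ such that the angle between the vectors $y-x$ and $z-x$ is $\alpha$. Let $\dim$ denote Hausdorff dimension. For $\alpha\in[0,180^\circ]$ and $\delta>0$ define $$\widetilde{C}(\alpha,\delta)=\sup\{\dim(A) : A\subset\mathbb{R}^n \text{ for some } n;\ A \text{ does not contain any angle from } (\alpha-\delta,\alpha+\delta)\},$$ where $A$ is an arbitrary set and $n$ is not fixed. The constant $C$ does not depend on $n$, $A$ or $\delta$.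
   Formalization: As stated the claim fails for δ near or above 1 (a line has dimension 1 and only the angles 0° and 180°); it is proved for 0<δ≤δ₁ with any fixed δ₁<1, the constant C depending only on δ₁, and with δ measured in radians. *)

(* Defs.v *)
From HB Require Import structures.
From mathcomp Require Export all_boot all_order all_algebra.
From mathcomp Require Export all_classical all_reals all_analysis.

Set Implicit Arguments.
Unset Strict Implicit.
Unset Printing Implicit Defensive.

Import Order.TTheory GRing.Theory Num.Theory.
Import numFieldNormedType.Exports.

Local Open Scope classical_set_scope.
Local Open Scope ring_scope.

(* The library norm on row vectors is the sup norm, hence the Euclidean
   structure below. The two norms induce the same topology. *)
Definition dotprod (R : realType) (n : nat) (u v : 'rV[R]_n) : R :=
  \sum_(i < n) u ord0 i * v ord0 i.

Definition enorm (R : realType) (n : nat) (u : 'rV[R]_n) : R :=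
  Num.sqrt (dotprod u u).

(* In radians, with values in [0, pi]. *)
Definition angle (R : realType) (n : nat) (u v : 'rV[R]_n) : R :=
  acos (dotprod u v / (enorm u * enorm v)).

Definition contains_angle (R : realType) (n : nat) (A : set 'rV[R]_n)
    (alpha : R) : Prop :=
  exists x y z : 'rV[R]_n,
    [/\ A x, A y & A z] /\ [/\ x <> y, x <> z & y <> z] /\
    angle (y - x) (z - x) = alpha.

(* The diameter of the empty set is -oo; [hgauge] treats that set apart. *)
Definition diam (R : realType) (n : nat) (U : set 'rV[R]_n) : \bar R :=
  ereal_sup [set d | exists x y, [/\ U x, U y & d = (enorm (x - y))%:E]].

(* diam(U)^s, with the usual conventions 0^0 = 1 and diam(set0)^s = 0. *)
Definition hgauge (R : realType) (n : nat) (s : R) (U : set 'rV[R]_n) :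
    \bar R :=
  if U == set0 then 0%E else poweR (diam U) s.

Definition hausdorff_premeasure (R : realType) (n : nat) (s eps : R)
    (A : set 'rV[R]_n) : \bar R :=
  ereal_inf [set t | exists U : nat -> set 'rV[R]_n,
    [/\ forall i, (diam (U i) <= eps%:E)%E,
        A `<=` \bigcup_i U i &
        t = (\sum_(0 <= i <oo) hgauge s (U i))%E]].

Definition hausdorff_measure (R : realType) (n : nat) (s : R)
    (A : set 'rV[R]_n) : \bar R :=
  ereal_sup [set hausdorff_premeasure s eps A | eps in [set e : R | 0 < e]].

Definition hausdorff_dim (R : realType) (n : nat) (A : set 'rV[R]_n) :
    \bar R :=
  ereal_inf [set s%:E | s in [set s : R | 0 <= s /\
                                          hausdorff_measure s A = 0%E]].

Definition baire_space : topologicalType :=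
  prod_topology (fun _ : nat => (nat : topologicalType)).

Definition analytic_set (T : topologicalType) (A : set T) : Prop :=
  A = set0 \/ exists2 f : baire_space -> T, continuous f & range f = A.

Definition Ctilde (R : realType) (alpha delta : R) : \bar R :=
  ereal_sup [set d | exists (n : nat) (A : set 'rV[R]_n),
    (forall theta : R, alpha - delta < theta < alpha + delta ->
       ~ contains_angle A theta) /\
    d = hausdorff_dim A].

(* 120 degrees. *)
Definition angle120 (R : realType) : R := 2 * pi / 3.

(* Main.v *)
(* It suffices to show that a set A which is not null for the s-dimensional
   Hausdorff measure contains an angle close to 120 degrees when 2^s exceeds
   M = (K + 1)^K with K of order 1 / delta.

   Call a triangle near-equilateral if its sides lie in [r, (1 + eta) r], with
   eta of order delta. Colour the pairs of a set of M + 1 points of diameter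
   rho, pairwise rho / 4 apart, by the length of the segment joining them,
   rounded to a multiple of eta rho / 4: there are K colours, so Ramsey's
   theorem gives a near-equilateral triangle. A bounded set without such
   triangles is therefore covered by M^k sets of diameter D / 2^k for every k,
   and is null since M < 2^s.

   Hence a non-null set contains a near-equilateral triangle (a, b, c) such that
   the set is not null near a. Iterating this near a gives an infinite sequence
   of triangles (a_k, b_k, c_k), the l-th one for l > k lying very close to a_k
   compared with the size of the k-th one. By the pigeonhole principle, two of
   them, k < l, are almost homothetic. Then c_l - b_l is almost parallel to
   c_k - b_k and b_k - b_l to b_k - a_k, so the angle at b_l between c_l and b_k
   is close to 180 - 60 = 120 degrees. *)

From mathcomp Require Import lra ring.
Require Import Defs.

Set Implicit Arguments.
Unset Strict Implicit.
Unset Printing Implicit Defensive.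

Import Order.TTheory GRing.Theory Num.Theory.
Import numFieldNormedType.Exports.

Local Open Scope classical_set_scope.
Local Open Scope ring_scope.

(** * Euclidean geometry *)

Section euclidean.
Context (R : realType) (n : nat).
Implicit Types (u v w : 'rV[R]_n) (a b e : R).

Lemma dotprodC u v : dotprod u v = dotprod v u.
Proof. by apply: eq_bigr => i _; rewrite mulrC. Qed.

Lemma dotprodDl u v w : dotprod (u + v) w = dotprod u w + dotprod v w.
Proof.
by rewrite /dotprod -big_split; apply: eq_bigr => i _; rewrite mxE mulrDl.
Qed.

Lemma dotprodZl a u v : dotprod (a *: u) v = a * dotprod u v.
Proof.
by rewrite /dotprod mulr_sumr; apply: eq_bigr => i _; rewrite mxE mulrA.
Qed.

Lemma dotprodNl u v : dotprod (- u) v = - dotprod u v.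
Proof. by rewrite -scaleN1r dotprodZl mulN1r. Qed.

Lemma dotprodDr u v w : dotprod u (v + w) = dotprod u v + dotprod u w.
Proof. by rewrite dotprodC dotprodDl !(dotprodC u). Qed.

Lemma dotprodZr a u v : dotprod u (a *: v) = a * dotprod u v.
Proof. by rewrite dotprodC dotprodZl (dotprodC u). Qed.

Lemma dotprodNr u v : dotprod u (- v) = - dotprod u v.
Proof. by rewrite dotprodC dotprodNl dotprodC. Qed.

Definition dotprodE := (dotprodDl, dotprodDr, dotprodNl, dotprodNr,
  dotprodZl, dotprodZr).

Lemma dotprod_ge0 u : 0 <= dotprod u u.
Proof. by apply: sumr_ge0 => i _; rewrite -expr2 sqr_ge0. Qed.

Lemma enorm_ge0 u : 0 <= enorm u.
Proof. exact: sqrtr_ge0. Qed.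

Lemma enorm_sqr u : enorm u ^+ 2 = dotprod u u.
Proof. by rewrite sqr_sqrtr ?dotprod_ge0. Qed.

Lemma coord_le_enorm u i : `|u ord0 i| <= enorm u.
Proof.
rewrite -sqrtr_sqr ler_wsqrtr // expr2 /dotprod (bigD1 i) //= lerDl.
by apply: sumr_ge0 => j _; rewrite -expr2 sqr_ge0.
Qed.

Lemma enorm_eq0 u : enorm u = 0 -> u = 0.
Proof.
move=> u0; apply/rowP => i; rewrite mxE; apply/eqP.
by rewrite -normr_le0 -u0 coord_le_enorm.
Qed.

Lemma enormZ a u : enorm (a *: u) = `|a| * enorm u.
Proof.
by rewrite /enorm dotprodZl dotprodZr mulrA -expr2 sqrtrM ?sqr_ge0 // sqrtr_sqr.
Qed.

Lemma enormN u : enorm (- u) = enorm u.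
Proof. by rewrite /enorm dotprodNl dotprodNr opprK. Qed.

Lemma enormBC u v : enorm (u - v) = enorm (v - u).
Proof. by rewrite -enormN opprB. Qed.

(** Cauchy-Schwarz, from the nonnegative squared norm of [dotprod v v *: u - dotprod u v *: v]. *)
Lemma dotprod_le_enorm u v : `|dotprod u v| <= enorm u * enorm v.
Proof.
have [/enorm_eq0 ->|v0] := eqVneq (enorm v) 0.
  rewrite -(scale0r (0 : 'rV[R]_n)) dotprodZr mul0r normr0.
  by rewrite mulr_ge0 ?enorm_ge0.
have v_gt0 : 0 < dotprod v v.
  by rewrite -enorm_sqr exprn_gt0 // lt0r v0 enorm_ge0.
rewrite -[X in _ <= X]ger0_norm ?mulr_ge0 ?enorm_ge0 //.
rewrite -ler_sqr ?nnegrE // !real_normK ?num_real // exprMn !enorm_sqr.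
have := dotprod_ge0 (dotprod v v *: u - dotprod u v *: v).
rewrite !dotprodE (dotprodC v u) => h.
rewrite -subr_ge0 -(pmulr_rge0 _ v_gt0); apply: le_trans h _.
by rewrite le_eqVlt; apply/orP; left; apply/eqP; ring.
Qed.

Lemma enormD u v : enorm (u + v) <= enorm u + enorm v.
Proof.
rewrite -ler_sqr ?nnegrE ?addr_ge0 ?enorm_ge0 //.
rewrite sqrrD !enorm_sqr !dotprodE (dotprodC v u).
have := dotprod_le_enorm u v; rewrite ler_norml => /andP[_ h].
by rewrite -mulr_natr; lra.
Qed.

Lemma enorm_sum_le (I : Type) (r : seq I) (F : I -> 'rV[R]_n) :
  enorm (\sum_(i <- r) F i) <= \sum_(i <- r) enorm (F i).
Proof.
elim/big_rec2 : _ => [|i y1 y2 _ h].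
  by rewrite /enorm -(scale0r (0 : 'rV[R]_n)) dotprodZr mul0r sqrtr0.
by apply: le_trans (enormD _ _) _; rewrite lerD2l.
Qed.

Lemma enorm_delta i : enorm (delta_mx ord0 i : 'rV[R]_n) = 1.
Proof.
rewrite /enorm /dotprod (bigD1 i) //= big1 => [|j ji]; rewrite !mxE ?eqxx.
  by rewrite mulr1 addr0 sqrtr1.
by rewrite (negPf ji) mulr0.
Qed.

Lemma enorm_le_coord u e : (forall i, `|u ord0 i| <= e) ->
  enorm u <= n%:R * e.
Proof.
move=> h; rewrite [u in enorm u]row_sum_delta.
apply: le_trans (enorm_sum_le _ _) _.
apply: (le_trans (y := \sum_(i < n) e)).
  by apply: ler_sum => i _; rewrite enormZ enorm_delta mulr1.
by rewrite sumr_const card_ord mulr_natl.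
Qed.

Lemma cosineZ a b u v : 0 < a -> 0 < b ->
  dotprod (a *: u) (b *: v) / (enorm (a *: u) * enorm (b *: v))
  = dotprod u v / (enorm u * enorm v).
Proof.
move=> a0 b0; rewrite dotprodZl dotprodZr !enormZ !gtr0_norm //.
rewrite mulrA mulrACA -[X in X / _]mulrA mulrA.
by rewrite -mulf_div divff ?mul1r // mulf_neq0 ?gt_eqF.
Qed.

End euclidean.

(** * Cosines and angles near 120 degrees *)

Section turn.
Context (R : realType).

(** Tripling the angle makes the cosine [c] a root of [4 * c ^+ 3 - 3 * c + 1], which factors as
    [(c + 1) * (2 * c - 1) ^+ 2]; and [c] is positive. *)
Lemma cos_pi3 : cos (pi / 3) = 1 / 2 :> R.
Proof.
have p2 := @pi_ge2 R.
have c0 : 0 < cos (pi / 3) :> R by apply: cos_gt0_pihalf; apply/andP; split; lra.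
have e1 : pi = pi / 3 + (pi / 3 + pi / 3) :> R by field.
have := cospi R; rewrite {1}e1 cosD cosD sinD.
have := cos2Dsin2 (pi / 3 : R); set c := cos _ in c0 *; set s := sin _.
move=> cs h.
have h2 : 4 * c ^+ 3 - 3 * c + 1 = 0.
  have e : c ^+ 3 - 3 * c * s ^+ 2 = - 1 by rewrite -h; ring.
  have s2 : s ^+ 2 = 1 - c ^+ 2 by lra.
  by rewrite s2 in e; lra.
have : (c + 1) * (2 * c - 1) ^+ 2 = 0 by rewrite -h2; ring.
move/eqP; rewrite mulf_eq0 sqrf_eq0 => /orP[|] /eqP; lra.
Qed.

Lemma acosN12 : acos (- (1 / 2)) = angle120 R.
Proof.
have p2 := @pi_ge2 R.
rewrite acosN; last by apply/andP; split; lra.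
rewrite -cos_pi3 cosK /angle120; first by field.
by rewrite in_itv /=; apply/andP; split; lra.
Qed.

(** Mean value theorem: between -3/4 and -1/4 the derivative of [acos] is at most 2 in absolute
    value. *)
Lemma acos_near120 (c : R) : `|c + 1 / 2| <= 1 / 4 ->
  `|acos c - angle120 R| <= 2 * `|c + 1 / 2|.
Proof.
move=> hc.
wlog suff wl : / forall x y : R, x <= y -> - (3 / 4) <= x -> y <= - (1 / 4) ->
   `|acos y - acos x| <= 2 * `|y - x|.
  rewrite -acosN12; move: hc; rewrite ler_norml => /andP[h1 h2].
  have -> : c + 1 / 2 = c - - (1 / 2) by rewrite opprK.
  have [h|/ltW h] := leP c (- (1 / 2)).
    by rewrite distrC (distrC c); apply: wl => //; lra.
  by apply: wl => //; lra.
move=> x y xy hx hy.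
have [||z] := @MVT_segment R (@acos R) (fun x => - (Num.sqrt (1 - x ^+ 2))^-1) x y xy.
- move=> z; rewrite in_itv /= => /andP[z1 z2]; apply: is_derive1_acos.
  by apply/andP; split; lra.
- apply: continuous_in_subspaceT => z; rewrite inE /= in_itv /= => /andP[z1 z2].
  by apply: continuous_acos; apply/andP; split; lra.
rewrite in_itv /= => /andP[z1 z2] ->.
rewrite normrM ler_wpM2r // normrN ger0_norm ?invr_ge0 ?sqrtr_ge0 //.
have h : 1 / 2 <= Num.sqrt (1 - z ^+ 2).
  have -> : 1 / 2 = Num.sqrt ((1 / 2) ^+ 2) :> R by rewrite sqrtr_sqr ger0_norm; lra.
  by rewrite ler_wsqrtr //; nra.
by rewrite invf_ple ?posrE //; lra.
Qed.

Context (n : nat).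
Implicit Types (p t v w : 'rV[R]_n).

(** Here [p] and [t] stand for [b - a] and [c - a] in a triangle rescaled to size about 1, [v] is
    close to [c - b] and [w] to [b - a]. By the law of cosines [dotprod (t - p) p] is close to -1/2;
    all the rest is an error of order [eta]. *)
Lemma cos_turn (eta : R) p t v w : 0 <= eta -> eta <= 1 / 20 ->
  1 <= enorm p <= 1 + eta -> 1 <= enorm t <= 1 + eta ->
  1 <= enorm (t - p) <= 1 + eta -> 1 <= enorm v <= 1 + eta ->
  enorm (v - (t - p)) <= eta -> enorm (w - p) <= eta ->
  `|dotprod v w / (enorm v * enorm w) + 1 / 2| <= 11 * eta.
Proof.
move=> e0 e1 /andP[p1 p2] /andP[t1 t2] /andP[q1 q2] /andP[v1 v2] hv hw.
have w1 : 1 - eta <= enorm w.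
  by have := enormD w (p - w); rewrite addrC subrK enormBC; lra.
have w2 : enorm w <= 1 + 2 * eta.
  by have := enormD p (w - p); rewrite addrC subrK; lra.
have tp : dotprod (t - p) p
    = (enorm t ^+ 2 - enorm p ^+ 2 - enorm (t - p) ^+ 2) / 2.
  by rewrite !enorm_sqr !dotprodE (dotprodC p t); field.
have -> : dotprod v w = dotprod (t - p) p + dotprod (v - (t - p)) p
    + dotprod v (w - p).
  by rewrite !dotprodE; ring.
have hx : `|dotprod (v - (t - p)) p| <= 2 * eta - eta / 2.
  apply: le_trans (dotprod_le_enorm _ _) _.
  by have := enorm_ge0 (v - (t - p)); nra.
have hy : `|dotprod v (w - p)| <= 2 * eta - eta / 2.
  apply: le_trans (dotprod_le_enorm _ _) _.
  by have := enorm_ge0 (w - p); nra.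
rewrite {}tp; move: (dotprod _ p) (dotprod v _) hx hy => x y hx hy.
move: hx hy; rewrite !ler_norml => /andP[x1 x2] /andP[y1 y2].
move: (enorm p) (enorm t) (enorm (t - p)) (enorm v) (enorm w)
  p1 p2 t1 t2 q1 q2 v1 v2 w1 w2 => P T Q V W p1 p2 t1 t2 q1 q2 v1 v2 w1 w2.
(* The bounds are kept linear in [eta], using [eta ^+ 2 <= eta / 20]. *)
have P2a : 1 <= P ^+ 2 by nra.
have P2b : P ^+ 2 <= 1 + 2 * eta + eta / 20 by nra.
have T2a : 1 <= T ^+ 2 by nra.
have T2b : T ^+ 2 <= 1 + 2 * eta + eta / 20 by nra.
have Q2a : 1 <= Q ^+ 2 by nra.
have Q2b : Q ^+ 2 <= 1 + 2 * eta + eta / 20 by nra.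
have D1 : 1 - eta <= V * W by nra.
have D2 : V * W <= 1 + 4 * eta by nra.
have D0 : 0 < V * W by lra.
set N := (X in X / (V * W)).
have -> : N / (V * W) + 1 / 2 = (N + (V * W) / 2) / (V * W).
  by field; apply/andP; split; apply/negP => /eqP h; lra.
have N1 : - (6 * eta) <= N + 1 / 2 by rewrite /N; lra.
have N2 : N + 1 / 2 <= 5 * eta by rewrite /N; lra.
by rewrite ler_pdivrMr ?ler_pdivlMr //; nra.
Qed.

End turn.

(** * Near-equilateral triangles and coverings *)

Lemma size_le_sum_count (T : eqType) (f : T -> nat) (cs : seq nat) (s : seq T) :
  (forall y, y \in s -> f y \in cs) ->
  (size s <= \sum_(c <- cs) count (fun y => f y == c) s)%N.
Proof.
elim: s => [//|y s IH] h /=.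
rewrite big_split /= -add1n leq_add //; last first.
  by apply: IH => z zs; apply: h; rewrite inE zs orbT.
have /(perm_big _) -> /= := perm_to_rem (h y (mem_head _ _)).
by rewrite big_cons eqxx.
Qed.

(** Ramsey's theorem for triangles, by induction on the number [k] of colours. Some colour [c] joins
    the first point to many others; either a pair of these has colour [c] and closes a triangle, or
    they use one colour fewer. *)
Lemma monochromatic_triangle (T : eqType) (chi : T -> T -> nat) (K k : nat)
    (cs : seq nat) (s : seq T) :
  (k <= K)%N -> (size cs <= k)%N -> uniq s ->
  {in s &, forall x y, x != y -> chi x y \in cs} ->
  (K.+1 ^ k < size s)%N ->
  exists x y z, [/\ x \in s, y \in s & z \in s] /\
    [/\ x != y, x != z, y != z, chi x z = chi x y & chi y z = chi x y].
Proof.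
elim: k cs s => [|k IH] cs s kK.
  case: cs => // _; case: s => [|x [|y s]] //= /andP[xys _] h _.
  have := h x y (mem_head _ _); rewrite !inE eqxx orbT => /(_ isT).
  by move: xys; rewrite inE negb_or => /andP[->] _ /(_ isT).
move=> scs; case: s => [//|x s] /= /andP[xs us] h; rewrite ltnS => szs.
have chix y : y \in s -> chi x y \in cs.
  move=> ys; apply: h; rewrite ?inE ?eqxx ?ys ?orbT //.
  by apply: contraNneq xs => ->.
(* Pigeonhole: at least [K.+1 ^ k.+1] points remain besides [x], for at most [K] colours. *)
have [c ccs hc] : exists2 c, c \in cs &
    (K.+1 ^ k < count (fun y => chi x y == c) s)%N.
  apply: contrapT => nc; have := leq_trans szs (size_le_sum_count chix).
  apply/negP; rewrite -ltnNge.
  apply: (@leq_ltn_trans (\sum_(c <- cs) K.+1 ^ k)).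
    rewrite big_seq [leqRHS]big_seq; apply: leq_sum => c ccs.
    by rewrite leqNgt; apply/negP => hc; apply: nc; exists c.
  rewrite big_const_seq count_predT iter_addn_0 mulnC expnS ltn_pmul2r ?expn_gt0 //.
  by rewrite ltnS (leq_trans scs).
pose t := [seq y <- s | chi x y == c].
have ts y : y \in t -> (chi x y = c) /\ (y \in s).
  by rewrite mem_filter => /andP[/eqP].
have tn y : y \in t -> x != y.
  by move=> /ts[_ ys]; apply: contraNneq xs => ->.
have [[y [z [yt zt yz cyz]]]|nt] := pselect (exists y z,
    [/\ y \in t, z \in t, y != z & chi y z = c]).
  have [[cy ys] [cz zs]] := (ts _ yt, ts _ zt).
  exists x, y, z; rewrite !inE eqxx ys zs !orbT !tn // cy cz cyz.
  by split.
have [||||y [z [w [[yt zt wt] H]]]] := IH (rem c cs) t (ltnW kK).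
- by rewrite size_rem // -ltnS (leq_trans _ scs) // prednK //; case: (cs) ccs.
- exact: filter_uniq.
- move=> y z yt zt yz.
  have [[cy ys] [cz zs]] := (ts _ yt, ts _ zt).
  have : chi y z \in cs by apply: h; rewrite // inE ?ys ?zs orbT.
  rewrite (perm_mem (perm_to_rem ccs)) inE => /orP[/eqP cyz|//].
  by case: nt; exists y, z.
- by rewrite size_filter.
by exists y, z, w; rewrite !inE (ts _ yt).2 (ts _ zt).2 (ts _ wt).2 !orbT.
Qed.

Section covering.
Context (R : realType) (n : nat).
Implicit Types (a b c x y : 'rV[R]_n) (A B E : set 'rV[R]_n) (r rho eta s : R).

Definition near_equilateral eta r a b c :=
  [/\ r <= enorm (b - a) <= (1 + eta) * r,
      r <= enorm (c - a) <= (1 + eta) * r &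
      r <= enorm (c - b) <= (1 + eta) * r].

(** Quantifying over all sizes [r] lets the halving below be repeated at every scale. *)
Definition triangle_free eta B := forall r a b c,
  0 < r -> B a -> B b -> B c -> ~ near_equilateral eta r a b c.

Definition diam_le rho E := forall x y, E x -> E y -> enorm (x - y) <= rho.

Lemma separated_near_equilateral eta rho (K : nat) (s : seq 'rV[R]_n) :
  0 < eta -> 0 < rho -> 4 / eta < K%:R -> uniq s ->
  {in s &, forall x y, x != y -> rho / 4 <= enorm (x - y) <= rho} ->
  (K.+1 ^ K < size s)%N ->
  exists r a b c, [/\ 0 < r, a \in s, b \in s & c \in s] /\
    near_equilateral eta r a b c.
Proof.
move=> eta0 rho0 hK us sep szs.
have er0 : 0 < eta * rho / 4 by rewrite divr_gt0 ?mulr_gt0.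
pose chi x y := Num.truncn (enorm (y - x) / (eta * rho / 4)).
have chiP x y : (chi x y)%:R * (eta * rho / 4) <= enorm (y - x)
    < (chi x y)%:R * (eta * rho / 4) + eta * rho / 4.
  have /andP[h1 h2] : (chi x y)%:R <= enorm (y - x) / (eta * rho / 4)
      < (chi x y).+1%:R by apply: truncn_itv; rewrite divr_ge0 ?enorm_ge0 ?ltW.
  rewrite -ler_pdivlMr // h1 /= -[X in _ < _ + X]mul1r -mulrDl -ltr_pdivrMr //.
  by rewrite natr1.
have [||x [y [z [[xs ys zs] [xy xz yz cz cyz]]]]] :=
    @monochromatic_triangle _ chi K K (iota 0 K) s (leqnn _) _ us _ szs.
- by rewrite size_iota.
- move=> x y xs ys xy; rewrite mem_iota add0n /= truncn_lt_nat; last first.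
    by rewrite divr_ge0 ?enorm_ge0 ?ltW.
  apply: le_lt_trans hK; rewrite ler_pdivrMr // enormBC.
  have -> : 4 / eta * (eta * rho / 4) = rho by field; rewrite gt_eqF.
  by have /andP[] := sep _ _ xs ys xy.
pose j := (chi x y)%:R * (eta * rho / 4).
(* The common rounded length [j] may fall below [rho / 4]. With the maximum, [r] is positive and the
   rounding step [eta * rho / 4] is at most [eta * r]. *)
exists (Num.max j (rho / 4)), x, y, z.
have r0 : 0 < Num.max j (rho / 4) by rewrite lt_max (divr_gt0 rho0) ?orbT.
split=> //.
have side u v : u \in s -> v \in s -> u != v -> chi u v = chi x y ->
    Num.max j (rho / 4) <= enorm (v - u) <= (1 + eta) * Num.max j (rho / 4).
  move=> us' vs uv e; have /andP[h1 h2] := chiP u v; rewrite e -/j in h1 h2.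
  have /andP[h3 _] := sep _ _ us' vs uv; rewrite enormBC in h3.
  rewrite ge_max h1 h3 /= mulrDl mul1r; apply: le_trans (ltW h2) _.
  by rewrite lerD ?le_max ?lexx // -mulrA ler_pM2l // le_max lexx orbT.
by split; exact: side.
Qed.

(** A maximal [rho / 4]-separated subset has at most [K.+1 ^ K] points, as a larger one would
    contain a triangle. By maximality the balls of radius [rho / 4] around it cover [E]. *)
Lemma triangle_free_halving eta rho (K : nat) E : 0 < eta -> 0 < rho ->
  4 / eta < K%:R -> triangle_free eta E -> diam_le rho E ->
  exists Fs : seq (set 'rV[R]_n), [/\ (size Fs <= K.+1 ^ K)%N,
    forall x, E x -> exists2 F, F \in Fs & F x &
    forall F, F \in Fs -> F `<=` E /\ diam_le (rho / 2) F].
Proof.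
move=> eta0 rho0 hK nt dE.
pose sepd (s : seq 'rV[R]_n) := [/\ uniq s, forall x, x \in s -> E x &
   {in s &, forall x y, x != y -> rho / 4 <= enorm (x - y)}].
pose P m := `[< exists2 s, size s = m & sepd s >].
have P0 : exists m, P m by exists 0%N; apply/asboolP; exists [::].
have Pb m : P m -> (m <= K.+1 ^ K)%N.
  move=> /asboolP[s <- [us sE sep]]; rewrite leqNgt; apply/negP => szs.
  have [x y xs ys xy|r [a [b [c [[r0 /sE as_ /sE bs /sE cs]]]]]] :=
    @separated_near_equilateral eta rho K s eta0 rho0 hK us _ szs.
    by rewrite sep //= dE //; apply: sE.
  exact: nt.
case: (ex_maxnP P0 Pb) => m Pm mmax; have szs := Pb _ Pm.
have /asboolP[s sm [us sE sep]] := Pm; rewrite -{}sm in mmax szs.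
exists [seq E `&` [set x | enorm (x - y) <= rho / 4] | y <- s]; split.
- by rewrite size_map.
- move=> x Ex; apply: contrapT => nx.
  have far y : y \in s -> rho / 4 < enorm (x - y).
    move=> ys; rewrite ltNge; apply/negP => h; apply: nx.
    by exists (E `&` [set x | enorm (x - y) <= rho / 4]) => //; apply: map_f.
  have xs : x \notin s.
    apply/negP => /far; rewrite subrr -(scale0r (0 : 'rV[R]_n)) enormZ normr0.
    by rewrite mul0r ltNge ltW // divr_gt0.
  suff /mmax : P (size (x :: s)) by rewrite ltnn.
  apply/asboolP; exists (x :: s) => //; split => [|y|y z]; rewrite /= ?xs //.
    by rewrite inE => /orP[/eqP->|/sE].
  rewrite !inE => /orP[/eqP->|ys] /orP[/eqP->|zs] yz; rewrite ?eqxx // in yz *.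
  - exact/ltW/far.
  - by rewrite enormBC; exact/ltW/far.
  - exact: sep.
- move=> F /mapP[y ys ->]; split; first exact: subIsetl.
  move=> u v [_ /= hu] [_ /= hv].
  have -> : u - v = (u - y) + (y - v) by rewrite addrA subrK.
  apply: le_trans (enormD _ _) _; rewrite (enormBC y); lra.
Qed.

Lemma triangle_free_covering eta rho (K k : nat) E : 0 < eta -> 0 < rho ->
  4 / eta < K%:R -> triangle_free eta E -> diam_le rho E ->
  exists Fs : seq (set 'rV[R]_n), [/\ (size Fs <= (K.+1 ^ K) ^ k)%N,
    forall x, E x -> exists2 F, F \in Fs & F x &
    forall F, F \in Fs -> F `<=` E /\ diam_le (rho / 2 ^+ k) F].
Proof.
move=> eta0 rho0 hK nt dE; elim: k => [|k [Fs [szF cF dF]]].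
  exists [:: E]; split=> // [x Ex|F]; first by exists E => //; rewrite inE.
  by rewrite mem_seq1 => /eqP ->; split=> //; rewrite expr0 divr1.
have rk0 : 0 < rho / 2 ^+ k by rewrite divr_gt0 ?exprn_gt0.
have /choice[G hG] : forall F : set 'rV[R]_n, exists Gs : seq (set 'rV[R]_n),
  F \in Fs -> [/\ (size Gs <= K.+1 ^ K)%N,
    forall x, F x -> exists2 G, G \in Gs & G x &
    forall G, G \in Gs -> G `<=` F /\ diam_le (rho / 2 ^+ k / 2) G].
  move=> F; have [FF|nF] := boolP (F \in Fs); last by exists [::].
  have [FE dF'] := dF _ FF.
  have ntF : triangle_free eta F.
    by move=> r a b c r0 /FE ? /FE ? /FE ?; exact: nt.
  have [Gs hGs] := triangle_free_halving eta0 rk0 hK ntF dF'.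
  by exists Gs.
exists (flatten [seq G F | F <- Fs]); split.
- rewrite size_flatten /shape -map_comp sumnE big_map.
  apply: (@leq_trans (\sum_(F <- Fs) K.+1 ^ K)).
    rewrite big_seq [leqRHS]big_seq; apply: leq_sum => F FF.
    by have [] := hG _ FF.
  by rewrite big_const_seq count_predT iter_addn_0 expnS leq_mul2l szF orbT.
- move=> x /cF[F FF Fx]; have [_ /(_ _ Fx)[H HG Hx] _] := hG _ FF.
  by exists H => //; apply/flatten_mapP; exists F.
- move=> H /flatten_mapP[F FF HG]; have [_ _ /(_ _ HG)[HF dH]] := hG _ FF.
  have [FE _] := dF _ FF; split; first exact: subset_trans HF FE.
  by rewrite exprSr invfM mulrA.
Qed.

End covering.

(** * Sets of Hausdorff measure zero *)

Section hausdorff_null.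
Context (R : realType) (n : nat).
Implicit Types (x y : 'rV[R]_n) (A B E : set 'rV[R]_n) (r rho eta s : R).

(** Vanishing of the Hausdorff measure stated through coverings, a form suited to countable
    unions. *)
Definition hausdorff_null s A := forall eps e : R, 0 < eps -> 0 < e ->
  exists U : nat -> set 'rV[R]_n,
    [/\ forall i, (diam (U i) <= eps%:E)%E, A `<=` \bigcup_i U i &
        (\sum_(0 <= i <oo) hgauge s (U i) <= e%:E)%E].

Lemma hgauge_ge0 s A : (0 <= hgauge s A)%E.
Proof. by rewrite /hgauge; case: ifP => // _; exact: poweR_ge0. Qed.

Lemma hgauge_set0 s : hgauge s (@set0 'rV[R]_n) = 0%E.
Proof. by rewrite /hgauge eqxx. Qed.

Lemma diam_le_diam rho A : diam_le rho A -> (diam A <= rho%:E)%E.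
Proof.
move=> dA; apply: ge_ereal_sup => _ [x [y [Ax Ay ->]]].
by rewrite lee_fin dA.
Qed.

Lemma hgauge_le s rho A : 0 <= s -> 0 <= rho -> diam_le rho A ->
  (hgauge s A <= (rho `^ s)%:E)%E.
Proof.
move=> s0 rho0 dA; rewrite /hgauge; case: ifPn => [_|/set0P[x Ax]].
  by rewrite lee_fin powR_ge0.
have d0 : (0 <= diam A)%E.
  apply: (@le_trans _ _ (enorm (x - x))%:E); first by rewrite lee_fin enorm_ge0.
  by apply: ereal_sup_ubound; exists x, x.
rewrite -poweR_EFin; apply: gt0_ler_poweR => //.
- by rewrite in_itv /= d0 leey.
- by rewrite in_itv /= lee_fin rho0 leey.
- exact: diam_le_diam.
Qed.

Lemma hausdorff_null_measure s A :
  hausdorff_null s A -> hausdorff_measure s A = 0%E.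
Proof.
move=> nA; have pm eps : 0 < eps -> hausdorff_premeasure s eps A = 0%E.
  move=> eps0; apply/eqP; rewrite eq_le; apply/andP; split.
    apply/lee_addgt0Pr => e e0; rewrite add0e.
    have [U [dU cU sU]] := nA _ _ eps0 e0.
    by apply: le_trans sU; apply: ereal_inf_lbound; exists U.
  apply: le_ereal_inf_tmp => _ [U [_ _ ->]].
  by apply: nneseries_ge0 => *; exact: hgauge_ge0.
rewrite /hausdorff_measure (_ : image _ _ = [set 0%E]) ?ereal_sup1 //.
apply/seteqP; split => [_ [eps /= eps0 <-]|_ ->]; first by rewrite pm.
by exists 1 => //=; rewrite pm.
Qed.

Lemma hausdorff_null_sub s A B : A `<=` B -> hausdorff_null s B ->
  hausdorff_null s A.
Proof.
move=> AB nB eps e eps0 e0; have [U [dU cU sU]] := nB _ _ eps0 e0.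
by exists U; split => //; exact: subset_trans AB cU.
Qed.

Lemma hausdorff_null_set0 s : hausdorff_null s set0.
Proof.
move=> eps e eps0 e0; exists (fun=> set0); split => // [_|].
  by rewrite diam_le_diam //; move=> x y [].
by rewrite eseries0 ?lee_fin ?ltW // => i _ _; rewrite hgauge_set0.
Qed.

(** The [i]-th set is covered at cost [e / 2 ^ i.+1]; a bijection from [nat] to pairs merges the
    coverings into one sequence. *)
Lemma hausdorff_null_bigcup s (A : nat -> set 'rV[R]_n) :
  (forall i, hausdorff_null s (A i)) -> hausdorff_null s (\bigcup_i A i).
Proof.
move=> nA eps e eps0 e0.
have ei i : 0 < e / (2 ^ i.+1)%:R by rewrite divr_gt0 // ltr0n expn_gt0.
have [U hU] := choice (fun i => nA i _ _ eps0 (ei i)).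
have /card_esym/ppcard_eqP[f] := card_nat2.
exists (fun k => U (f k).1 (f k).2); split.
- by move=> k; have [] := hU (f k).1.
- move=> x [i _ Ax]; have [_ /(_ _ Ax)[j _ Ux] _] := hU i.
  by exists (f^-1%FUN (i, j)) => //=; rewrite invK ?inE.
rewrite nneseries_esumT; last by move=> k; exact: hgauge_ge0.
rewrite -(@reindex_esum R _ _ setT setT f (fun p => hgauge s (U p.1 p.2))) //.
rewrite (_ : setT = setT `*`` (fun=> setT)); last by apply/seteqP; split.
rewrite -(@esum_esum R _ _ setT (fun=> setT) (fun i j => hgauge s (U i j))).
  rewrite -nneseries_esumT; last by move=> i; apply: esum_ge0 => *; exact: hgauge_ge0.
  apply: le_trans (epsilon_trick0 xpredT (ltW e0)).
  apply: lee_nneseries => [i _ _|i _]; first by apply: esum_ge0 => *; exact: hgauge_ge0.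
  have [_ _] := hU i; rewrite nneseries_esumT // => j; exact: hgauge_ge0.
by move=> *; exact: hgauge_ge0.
Qed.

Lemma triangle_free_null s eta rho (K : nat) E : 0 <= s -> 0 < eta ->
  4 / eta < K%:R -> (K.+1 ^ K)%:R < 2 `^ s -> triangle_free eta E ->
  0 < rho -> diam_le rho E -> hausdorff_null s E.
Proof.
move=> s0 eta0 hK hs nt rho0 dE eps e eps0 e0.
set M := (K.+1 ^ K)%N in hs *.
(* The [k]-th covering costs at most [M ^ k * (rho / 2 ^ k) ^ s], that is, [rho ^ s * q ^ k]. *)
pose q := M%:R / 2 `^ s.
have q0 : 0 <= q by rewrite divr_ge0 ?powR_ge0.
have q1 : q < 1 by rewrite ltr_pdivrMr ?mul1r ?powR_gt0.
have [k [hk1 hk2]] : exists k : nat, rho / 2 ^+ k <= eps /\ rho `^ s * q ^+ k <= e.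
  have z1 : `|2^-1| < 1 :> R by rewrite ger0_norm // invf_lt1 // ltr1n.
  have z2 : `|q| < 1 by rewrite ger0_norm.
  have /cvgrPdist_lt/(_ _ eps0) h1 := cvg_geometric rho z1.
  have /cvgrPdist_lt/(_ _ e0) h2 := cvg_geometric (rho `^ s) z2.
  have [k [/ltW + /ltW]] := filter_ex (filterI h1 h2).
  rewrite !sub0r !normrN /geometric /= !ger0_norm ?exprVn.
  - by exists k.
  - by rewrite mulr_ge0 ?powR_ge0 ?exprn_ge0.
  - by rewrite mulr_ge0 ?invr_ge0 ?exprn_ge0 // ltW.
have [Fs [szF cF dF]] := triangle_free_covering k eta0 rho0 hK nt dE.
have rk0 : 0 <= rho / 2 ^+ k by rewrite divr_ge0 ?exprn_ge0 // ltW.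
have dU i : diam_le (rho / 2 ^+ k) (nth set0 Fs i).
  have [ik|ik] := ltnP i (size Fs); first by have [] := dF _ (mem_nth set0 ik).
  by rewrite nth_default // => x y [].
(* The finite covering is padded with empty sets, whose gauge is 0. *)
exists (nth set0 Fs); split.
- move=> i; apply: le_trans (diam_le_diam (dU i)) _.
  by rewrite lee_fin.
- move=> x /cF[F FF Fx]; exists (index F Fs) => //.
  by rewrite nth_index.
rewrite (nneseries_split 0 (size Fs)); last by move=> *; exact: hgauge_ge0.
rewrite add0n [X in (_ + X)%E]eseries0; last first.
  by move=> i hi _; rewrite nth_default // hgauge_set0.
rewrite adde0; apply: (@le_trans _ _ (\sum_(0 <= i < size Fs) ((rho / 2 ^+ k) `^ s)%:E)%E).
  by apply: lee_sum => i _; exact: hgauge_le.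
rewrite sumEFin lee_fin sumr_const_nat subn0; apply: le_trans hk2.
rewrite -[leLHS]mulr_natl powRM ?invr_ge0 ?exprn_ge0 ?(ltW rho0) //.
rewrite mulrCA ler_wpM2l ?powR_ge0 //.
rewrite -exprVn -powR_mulrn ?invr_ge0 // powRAC powR_mulrn ?powR_ge0 //.
rewrite /q exprMn -natrX -powR_inv1 // -powRrM mulN1r powRN.
by rewrite ler_wpM2r ?exprn_ge0 ?invr_ge0 ?powR_ge0 // ler_nat.
Qed.

(** An open ball of the sup norm; passing to the Euclidean norm costs a factor [n]. *)
Definition cube x r := [set y : 'rV[R]_n | forall i, `|y ord0 i - x ord0 i| < r].

Lemma cube_diam_le x r : diam_le (n%:R * (2 * r)) (cube x r).
Proof.
move=> y z yx zx; apply: enorm_le_coord => i; rewrite !mxE.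
have -> : y ord0 i - z ord0 i = (y ord0 i - x ord0 i) - (z ord0 i - x ord0 i).
  by rewrite opprB addrA subrK.
apply: le_trans (ler_normB _ _) _.
by have := yx i; have := zx i; lra.
Qed.

(* Lindelöf's argument, with the cubes of rational centre and radius
   [1 / m.+1] as a countable base. *)
Lemma hausdorff_null_local s A :
  (forall x, A x -> exists2 r, 0 < r & hausdorff_null s (A `&` cube x r)) ->
  hausdorff_null s A.
Proof.
move=> locA.
pose ratv (q : 'rV[rat]_n) : 'rV[R]_n := map_mx ratr q.
(* The null pieces are enumerated by their codes; invalid codes and pieces that are not null give
   the empty set. *)
pose piece (k : nat) : set 'rV[R]_n :=
  if @unpickle ('rV[rat]_n * nat)%type k is Some (q, m) then
    let B := A `&` cube (ratv q) m.+1%:R^-1 in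
    if `[< hausdorff_null s B >] then B else set0
  else set0.
have npiece k : hausdorff_null s (piece k).
  rewrite /piece; case: unpickle => [[q m]|]; last exact: hausdorff_null_set0.
  by case: asboolP => // _; exact: hausdorff_null_set0.
apply: hausdorff_null_sub (hausdorff_null_bigcup npiece) => x Ax.
have [r r0 nr] := locA x Ax.
(* The factor 2 adds the distance from [x] to the rational centre and the radius of the rational
   cube. *)
have [m hm] : exists m : nat, 2 * m.+1%:R^-1 < r.
  exists (Num.truncn (2 / r)); rewrite ltr_pdivrMr // mulrC -ltr_pdivrMr //.
  exact: truncnS_gt.
have /choice[q hq] : forall i : 'I_n, exists q : rat,
    `|ratr q - x ord0 i| < m.+1%:R^-1.
  move=> i; have [|q] := @rat_in_itvoo R (x ord0 i - m.+1%:R^-1) (x ord0 i + m.+1%:R^-1).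
    by rewrite ltrD2l gtrN // invr_gt0.
  by rewrite in_itv /= => hq; exists q; rewrite ltr_distl.
pose Q : 'rV[rat]_n := \row_i q i.
exists (pickle (Q, m)) => //; rewrite /piece pickleK.
have sub : A `&` cube (ratv Q) m.+1%:R^-1 `<=` A `&` cube x r.
  move=> y [Ay hy]; split => // i; apply: lt_trans hm.
  have := hy i; have := hq i; rewrite /ratv !mxE => h1 h2.
  have -> : y ord0 i - x ord0 i = (y ord0 i - ratr (q i)) + (ratr (q i) - x ord0 i).
    by rewrite addrA subrK.
  by apply: le_lt_trans (ler_normD _ _) _; rewrite mulr_natl mulr2n ltrD.
have /asboolT -> : hausdorff_null s (A `&` cube (ratv Q) m.+1%:R^-1).
  exact: hausdorff_null_sub sub nr.
by split => // i; rewrite /ratv !mxE distrC.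
Qed.

(** [G] consists of the points near which [A] is nowhere null, however small the cube. Its
    complement in [A] is locally null, hence null, so [G] cannot be null. *)
Lemma not_hausdorff_null_core s A : ~ hausdorff_null s A ->
  exists G : set 'rV[R]_n, [/\ G `<=` A, ~ hausdorff_null s G &
    forall x r, G x -> 0 < r -> ~ hausdorff_null s (A `&` cube x r)].
Proof.
move=> nA.
pose G := [set x | A x /\ forall r, 0 < r -> ~ hausdorff_null s (A `&` cube x r)].
exists G; split; [by move=> x []| |by move=> x r [_ h]; exact: h].
move=> nG; apply: nA; pose B := A `\` G.
have nB : hausdorff_null s B.
  apply: hausdorff_null_local => x [Ax nGx]; apply: contrapT => nx.
  apply: nGx; split => // r r0 nr; apply: nx; exists r => //.
  by apply: hausdorff_null_sub nr => y [[Ay _] hy].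
pose BG i := if i is 0%N then B else G.
have nBG i : hausdorff_null s (BG i) by case: i.
apply: hausdorff_null_sub (hausdorff_null_bigcup nBG) => x Ax.
have [Gx|nGx] := pselect (G x); first by exists 1%N.
by exists 0%N.
Qed.

End hausdorff_null.

(** * Nested triangles *)

Lemma pigeonhole_nat (F : finType) (f : nat -> F) :
  exists k l : nat, (k < l)%N /\ f k = f l.
Proof.
apply: contrapT => nf.
have finj : injective (fun i : 'I_#|F|.+1 => f i).
  move=> i j fij; apply: val_inj => /=.
  by have [ij|ji|//] := ltngtP i j; case: nf; [exists i, j|exists j, i].
by have := leq_card _ finj; rewrite card_ord ltnn.
Qed.

Section chain.
Context (R : realType) (n : nat).
Implicit Types (a b c x y z : 'rV[R]_n) (A S : set 'rV[R]_n).

(** Coordinates are rounded on a grid. The number of colours depends on [n], but it only affects how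
    far along the infinite sequence two similar triangles appear, not the constant [C]. *)
Lemma finite_direction_coloring (e : R) : 0 < e ->
  exists (F : finType) (col : 'rV[R]_n -> F), forall u v,
    enorm u <= 2 -> enorm v <= 2 -> col u = col v -> enorm (u - v) <= e.
Proof.
move=> e0; pose d := e / n.+1%:R.
have d0 : 0 < d by rewrite divr_gt0.
pose m := Num.truncn (4 / d).
pose t (u : 'rV[R]_n) i := Num.truncn ((u ord0 i + 2) / d).
exists {ffun 'I_n -> 'I_m.+1}, (fun u => [ffun i => inord (t u i)]).
have tP u i : enorm u <= 2 -> (t u i < m.+1)%N /\
    (t u i)%:R * d <= u ord0 i + 2 < (t u i)%:R * d + d.
  move=> u2; have := le_trans (coord_le_enorm u i) u2.
  rewrite ler_norml => /andP[h1 h2].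
  have h0 : 0 <= (u ord0 i + 2) / d by rewrite divr_ge0 ?(ltW d0) //; lra.
  split; first by rewrite ltnS le_truncn // ler_pM2r ?invr_gt0 //; lra.
  have /andP[h3 h4] := truncn_itv h0.
  rewrite -ler_pdivlMr // h3 /= -[X in _ < _ + X]mul1r -mulrDl -ltr_pdivrMr //.
  by rewrite natr1.
move=> u v u2 v2 uv; apply: (@le_trans _ _ (n%:R * d)).
  apply: enorm_le_coord => i; rewrite !mxE.
  have [[hu1 /andP[hu2 hu3]] [hv1 /andP[hv2 hv3]]] := (tP u i u2, tP v i v2).
  have tuv : t u i = t v i.
    move/ffunP/(_ i): uv; rewrite !ffunE => /(congr1 val) /=.
    by rewrite !inordK.
  by rewrite tuv in hu2 hu3; rewrite ler_norml; apply/andP; split; lra.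
by rewrite mulrCA ler_piMr ?(ltW e0) // ler_pdivrMr // mul1r ler_nat.
Qed.

(** The triangle is taken in the core of [S], so that [S] is not null near its vertex [a] and the
    construction can continue there. *)
Lemma not_null_triangle (s eta kappa rho : R) (K : nat) S :
  0 <= s -> 0 < eta -> 0 < kappa -> 4 / eta < K%:R ->
  (K.+1 ^ K)%:R < 2 `^ s -> 0 < rho -> diam_le rho S ->
  ~ hausdorff_null s S ->
  exists r a b c S', [/\ 0 < r, S a, S b, S c & near_equilateral eta r a b c] /\
    [/\ S' `<=` S, S' `<=` cube a (kappa * r) & ~ hausdorff_null s S'].
Proof.
move=> s0 eta0 k0 hK hs rho0 dS nS.
have [G [GS nG cG]] := not_hausdorff_null_core nS.
apply: contrapT => nT; apply: nG.
apply: (@triangle_free_null R n s eta rho K) => //; last first.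
  by move=> x y /GS Sx /GS Sy; exact: dS.
move=> r a b c r0 Ga Gb Gc T; apply: nT.
exists r, a, b, c, (S `&` cube a (kappa * r)).
split; first by split => //; exact: GS.
split; [exact: subIsetl | exact: subIsetr |].
by apply: cG => //; rewrite mulr_gt0.
Qed.

Lemma not_null_turn (s eta : R) (K : nat) A :
  0 <= s -> 0 < eta -> eta <= 1 / 20 -> 4 / eta < K%:R ->
  (K.+1 ^ K)%:R < 2 `^ s -> ~ hausdorff_null s A ->
  exists x y z, [/\ A x, A y & A z] /\
    `|dotprod (y - x) (z - x) / (enorm (y - x) * enorm (z - x)) + 1 / 2|
      <= 11 * eta.
Proof.
move=> s0 eta0 eta1 hK hs nA.
have [G [GA nG cG]] := not_hausdorff_null_core nA.
have [x0 Gx0] : exists x, G x.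
  apply: contrapT => nx; apply: nG; rewrite (_ : G = set0).
    exact: hausdorff_null_set0.
  by rewrite -subset0 => x Gx; apply: nx; exists x.
(* Cutting at a core point makes the set bounded and keeps it non-null. *)
pose S0 := A `&` cube x0 1.
pose rho : R := n%:R * (2 * 1) + 1.
have rho0 : 0 < rho by rewrite /rho ltr_wpDl ?mulr_ge0.
have dS0 : diam_le rho S0.
  move=> x y [_ hx] [_ hy]; apply: le_trans (cube_diam_le hx hy) _.
  by rewrite lerDl.
(* Since [n * kappa <= eta], the cube of radius [kappa * r] lies within Euclidean distance [eta * r]
   of its centre. *)
pose kappa := eta / n.+1%:R.
have k0 : 0 < kappa by rewrite divr_gt0.
pose good S := S `<=` S0 /\ ~ hausdorff_null s S.
pose rel S (d : R * 'rV[R]_n * 'rV[R]_n * 'rV[R]_n * set 'rV[R]_n) :=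
  let: (r, a, b, c, S') := d in
  [/\ 0 < r, S a, S b, S c & near_equilateral eta r a b c] /\
  [/\ S' `<=` S, S' `<=` cube a (kappa * r) & ~ hausdorff_null s S'].
have /choice[f fP] : forall S, exists d, good S -> rel S d.
  move=> S; have [[SS0 nS]|ng] := pselect (good S); last first.
    by exists (1, x0, x0, x0, set0).
  have dS : diam_le rho S by move=> x y /SS0 ? /SS0 ?; exact: dS0.
  have [r [a [b [c [S' h]]]]] := not_null_triangle s0 eta0 k0 hK hs rho0 dS nS.
  by exists (r, a, b, c, S').
pose St k := iter k (fun S => (f S).2) S0.
have goodSt k : good (St k).
  elim: k => [|k IH]; first by split => //; exact: cG.
  have := fP _ IH; rewrite /= /rel; case: (f (St k)) => [[[[r a] b] c] S'] /=.
  move=> [_ [S'S _ nS']]; split => //.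
  by apply: subset_trans S'S _; case: IH.
pose r k := (f (St k)).1.1.1.1.
pose a k := (f (St k)).1.1.1.2.
pose b k := (f (St k)).1.1.2.
pose c k := (f (St k)).1.2.
have relk k : [/\ 0 < r k, St k (a k), St k (b k), St k (c k) &
      near_equilateral eta (r k) (a k) (b k) (c k)] /\
    (St k.+1 `<=` St k /\ St k.+1 `<=` cube (a k) (kappa * r k)).
  have := fP _ (goodSt k); rewrite /r /a /b /c /rel /=.
  by case: (f (St k)) => [[[[r' a'] b'] c'] S'] /= [? []].
have Santi k m : St (k + m)%N `<=` St k.
  elim: m => [|m IH]; first by rewrite addn0.
  by rewrite addnS; apply: subset_trans IH; have [_ []] := relk (k + m)%N.
pose P k := (r k)^-1 *: (b k - a k).
pose T k := (r k)^-1 *: (c k - a k).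
have r0 k : 0 < r k by have [[]] := relk k.
have unit k (u : 'rV[R]_n) : r k <= enorm u <= (1 + eta) * r k ->
    1 <= enorm ((r k)^-1 *: u) <= 1 + eta.
  move=> /andP[h1 h2]; rewrite enormZ gtr0_norm ?invr_gt0 //.
  by rewrite [_^-1 * _]mulrC ler_pdivlMr // mul1r h1 ler_pdivrMr.
have TP k : T k - P k = (r k)^-1 *: (c k - b k).
  by rewrite /T /P -scalerBr opprB addrA subrK.
have Pu k : 1 <= enorm (P k) <= 1 + eta.
  by apply: unit; have [[_ _ _ _ []]] := relk k.
have Tu k : 1 <= enorm (T k) <= 1 + eta.
  by apply: unit; have [[_ _ _ _ []]] := relk k.
have TPu k : 1 <= enorm (T k - P k) <= 1 + eta.
  by rewrite TP; apply: unit; have [[_ _ _ _ []]] := relk k.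
(* Half of [eta] for each of [P] and [T], whose errors add up in [T - P]. *)
have eta2 : 0 < eta / 2 by rewrite divr_gt0.
have [F [col colP]] := finite_direction_coloring eta2.
have [k [l [kl [colPkl colTkl]]]] := pigeonhole_nat (fun k => (col (P k), col (T k))).
have le2 u : 1 <= u <= 1 + eta -> u <= 2 by lra.
have hP := colP _ _ (le2 _ (Pu k)) (le2 _ (Pu l)) colPkl.
have hT := colP _ _ (le2 _ (Tu k)) (le2 _ (Tu l)) colTkl.
(* As [k < l], [b l] lies in the cube around [a k], so [w] is close to [P k]. *)
pose w := (r k)^-1 *: (b k - b l).
have hw : enorm (w - P k) <= eta.
  rewrite /w /P -scalerBr opprB addrC addrA subrK.
  rewrite enormZ gtr0_norm ?invr_gt0 // mulrC ler_pdivrMr //.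
  have : cube (a k) (kappa * r k) (b l).
    have [_ [_]] := relk k; apply.
    by apply: (Santi k.+1 (l - k.+1)%N); rewrite subnKC //; have [[]] := relk l.
  move=> hbl; rewrite enormBC.
  apply: (@le_trans _ _ (n%:R * (kappa * r k))).
    by apply: enorm_le_coord => i; rewrite !mxE ltW.
  rewrite mulrA ler_pM2r // mulrCA ler_piMr ?(ltW eta0) //.
  by rewrite ler_pdivrMr // mul1r ler_nat.
have hv : enorm (T l - P l - (T k - P k)) <= eta.
  have -> : T l - P l - (T k - P k) = (P k - P l) - (T k - T l).
    by apply/rowP => i; rewrite !mxE; ring.
  by apply: le_trans (enormD _ _) _; rewrite enormN; lra.
have StA m : St m `<=` A by move=> x; case: (goodSt m) => h _ /h[].
have [[_ _ bk _ _] _] := relk k; have [[_ _ bl cl _] _] := relk l.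
exists (b l), (c l), (b k); split; first by split; apply: StA; eassumption.
have -> : c l - b l = r l *: (T l - P l) by rewrite TP scalerKV ?gt_eqF.
have -> : b k - b l = r k *: w by rewrite scalerKV ?gt_eqF.
(* The two sides at [b l] have the different scales [r l] and [r k], which cancel in the cosine. *)
by rewrite cosineZ //; apply: (cos_turn _ _ (Pu k) (Tu k)); rewrite ?(ltW eta0).
Qed.

(** Coinciding points would make the quotient 0 ([x = y] or [x = z]) or 1 ([y = z]), both far from
    -1/2. *)
Lemma turn_contains_angle A x y z : A x -> A y -> A z ->
  `|dotprod (y - x) (z - x) / (enorm (y - x) * enorm (z - x)) + 1 / 2| <= 1 / 4 ->
  contains_angle A (angle (y - x) (z - x)).
Proof.
move=> Ax Ay Az; set q := dotprod _ _ / _ => hq; exists x, y, z.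
have q0 : q <> 0 by move=> q0; move: hq; rewrite q0 ger0_norm; lra.
have xy : x <> y.
  move=> e; apply: q0; rewrite /q e subrr -(scale0r (0 : 'rV[R]_n)) dotprodZl.
  by rewrite !mul0r.
have xz : x <> z.
  move=> e; apply: q0; rewrite /q e subrr -(scale0r (0 : 'rV[R]_n)) dotprodZr.
  by rewrite !mul0r.
split=> //; split=> //; split=> // yz.
have q1 : q = 1.
  rewrite /q yz -expr2 enorm_sqr divff // -enorm_sqr sqrf_eq0.
  by apply/eqP => /enorm_eq0/subr0_eq /esym.
by move: hq; rewrite q1 ger0_norm; lra.
Qed.

End chain.

(** * Choice of the constant and conclusion *)

Lemma ramsey_constant (R : realType) (delta1 : R) : delta1 < 1 ->
  exists C : R, forall delta : R, 0 < delta -> delta <= delta1 ->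
    let s := C / delta * ln (1 / delta) in
    exists K : nat, [/\ 0 <= s, 4 / (delta / 48) < K%:R &
      (K.+1 ^ K)%:R < 2 `^ s].
Proof.
move=> d1.
have ln2 : 0 < ln 2 :> R by rewrite ln_gt0 // ltr1n.
have l194 : 0 <= ln 194 :> R by rewrite ln_ge0 // ler1n.
pose L1 := ln (1 / delta1).
(* With [K] at most [193 / d], [K * ln K.+1] is at most [193 / d * (ln 194 + L)]. The additive
   [ln 194] is absorbed by [L >= L1 > 0]; the excess of 194 over 193 makes the inequality strict. *)
pose C := 194 / ln 2 * (ln 194 / L1 + 1).
exists C => d d0 dd1.
have d10 : 0 < delta1 by apply: lt_le_trans dd1.
have L10 : 0 < L1 by rewrite ln_gt0 // ltr_pdivlMr // mul1r.
have L1d : L1 <= ln (1 / d).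
  by rewrite ler_ln ?posrE ?divr_gt0 // !div1r lef_pV2 ?posrE.
set L := ln (1 / d) in L1d *; have L0 : 0 < L by apply: lt_le_trans L1d.
pose K := (Num.truncn (192 / d)).+1.
have K1 : 192 / d < K%:R by exact: truncnS_gt.
have d1' : 1 <= d^-1 by rewrite invf_ge1 // ltW // (le_lt_trans dd1).
have K2 : K%:R <= 193 / d.
  have h : (Num.truncn (192 / d))%:R <= 192 / d.
    by rewrite truncn_le divr_ge0 // ltW.
  have -> : K%:R = (Num.truncn (192 / d))%:R + 1 :> R by rewrite natr1.
  lra.
exists K; split.
- have C0 : 0 <= C by rewrite mulr_ge0 ?addr_ge0 ?divr_ge0 ?(ltW ln2) ?(ltW L10).
  by rewrite mulr_ge0 ?divr_ge0 ?(ltW L0) ?(ltW d0).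
- by have -> : 4 / (d / 48) = 192 / d by field; rewrite gt_eqF.
have M0 : 0 < (K.+1 ^ K)%:R :> R by rewrite ltr0n expn_gt0.
rewrite -ltr_ln ?posrE ?powR_gt0 // ln_powR natrX lnXn ?ltr0n // -[ltLHS]mulr_natl.
have lnK : ln K.+1%:R <= ln 194 + L.
  rewrite -lnM ?posrE ?divr_gt0 // ler_ln ?posrE ?mulr_gt0 ?invr_gt0 //.
  have -> : K.+1%:R = K%:R + 1 :> R by rewrite natr1.
  lra.
have -> : C / d * L * ln 2 = 194 / d * (ln 194 * (L / L1) + L).
  by rewrite /C; field; rewrite !gt_eqF.
have LL1 : 1 <= L / L1 by rewrite ler_pdivlMr // mul1r.
have lnK0 : 0 <= ln K.+1%:R :> R by rewrite ln_ge0 // ler1n.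
apply: (@le_lt_trans _ _ (193 / d * (ln 194 + L))).
  by apply: ler_pM.
apply: (@lt_le_trans _ _ (194 / d * (ln 194 + L))).
  by rewrite ltr_pM2r ?ltr_wpDl // ltr_pM2r ?invr_gt0 // ltr_nat.
by rewrite ler_pM2l ?divr_gt0 // lerD2r -[leLHS]mulr1 ler_wpM2l.
Qed.

(* For delta close to 1 the bound is close to 0 (and negative beyond 1), and a
   line, which has dimension 1 and only the angles 0 and pi, refutes the claim
   for every C. The range of delta is therefore ]0, delta1], for an arbitrary
   delta1 < 1. *)
Theorem theorem4p12 (R : realType) (delta1 : R) (delta1_lt1 : delta1 < 1) :
  exists C : R, forall delta : R, 0 < delta -> delta <= delta1 ->
    (forall (n : nat) (A : set 'rV[R]_n), analytic_set A ->
       ((C / delta * ln (1 / delta))%:E < hausdorff_dim A)%E ->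
       exists theta : R,
         contains_angle A theta /\
         angle120 R - delta < theta < angle120 R + delta)
    /\ (Ctilde (angle120 R) delta <= (C / delta * ln (1 / delta))%:E)%E.
Proof.
have [C hC] := ramsey_constant delta1_lt1.
exists C => delta d0 dd1.
have [K [s0 hK hs]] := hC _ d0 dd1; set s := C / delta * _ in s0 hs *.
(* This bound gives both claims, the first by contraposition. *)
have small (n : nat) (A : set 'rV[R]_n) :
    (forall theta, angle120 R - delta < theta < angle120 R + delta ->
      ~ contains_angle A theta) -> (hausdorff_dim A <= s%:E)%E.
  move=> nA; apply: ereal_inf_lbound; exists s => //=; split=> //.
  apply: hausdorff_null_measure; apply: contrapT => nnA.
  (* With 48, the cosine error [11 * eta] is below 1/4 and the angle error [22 * eta] is below
     [delta]. *)
  have eta0 : 0 < delta / 48 by rewrite divr_gt0.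
  have eta1 : delta / 48 <= 1 / 20 by lra.
  have [x [y [z [[Ax Ay Az] hq]]]] := not_null_turn s0 eta0 eta1 hK hs nnA.
  have hq4 : `|dotprod (y - x) (z - x) / (enorm (y - x) * enorm (z - x)) + 1 / 2|
      <= 1 / 4 by apply: le_trans hq _; lra.
  apply: (nA (angle (y - x) (z - x))); last exact: turn_contains_angle.
  rewrite -ltr_distl; apply: le_lt_trans (acos_near120 hq4) _; lra.
split; last by apply: ge_ereal_sup => _ [n [A [nA ->]]]; exact: small.
move=> n A _ hA; apply: contrapT => noangle.
have := small n A; rewrite leNgt hA => small_nA; apply/notF/small_nA.
by move=> theta hth cth; apply: noangle; exists theta.
Qed.
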